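(* Let $n\geq 1$ and let $x_1,\dots,x_n\in(0,\tfrac12]$ be not all equal. With $A_n,G_n,A'_n,G'_n$ and $I$ as in the context, $$\frac{A'_n}{G'_n}<\left(\frac{A_n}{G_n}\right)^{\frac{A_n+G_n}{A'_n+G'_n}\cdot\frac{A'_n-G'_n}{A_n-G_n}}<\min\left\{\left(\frac{A_n}{G_n}\right)^{\frac{A_n+G_n}{A'_n+G'_n}},\left(\frac{A_n}{G_n}\right)^{\frac{A'_n-G'_n}{A_n-G_n}}\right\}<\frac{A_n}{G_n},$$ $$\frac{A'_n}{G'_n}<\left(\frac{A'_n}{G'_n}\right)^{\frac{I(A'_n,G'_n)}{I(A_n,G_n)}\cdot\frac{A_n-G_n}{A'_n-G'_n}}<\frac{A_n}{G_n},$$ and $$\frac{A_nG_n}{A'_nG'_n}<\min\left\{\left[\frac{\frac{1}{A'_n-G'_n}\ln\frac{A'_n}{G'_n}}{\frac{1}{A_n-G_n}\ln\frac{A_n}{G_n}}\right]^2,\ \left[\frac{\frac{1}{{A'_n}^n-{G'_n}^n}\ln\frac{{A'_n}^n}{{G'_n}^n}}{\frac{1}{{A_n}^n-{G_n}^n}\ln\frac{{A_n}^n}{{G_n}^n}}\right]^{\frac2n}\right\}<1.$$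
   Context: $A_n=\frac1n\sum_{i=1}^n x_i$ and $G_n=\prod_{i=1}^n x_i^{1/n}$ are the arithmetic and geometric means of $x_1,\dots,x_n$; $A'_n=\frac1n\sum_{i=1}^n(1-x_i)$ and $G'_n=\prod_{i=1}^n(1-x_i)^{1/n}$ are the arithmetic and geometric means of $1-x_1,\dots,1-x_n$. For $u,v>0$ the identric mean is $I(u,v)=\frac{1}{e}\left(\frac{u^u}{v^v}\right)^{1/(u-v)}$ if $u\neq v$ and $I(u,u)=u$. *)

(* Defs.v *)
From mathcomp Require Import all_boot all_order all_algebra.
From mathcomp Require Import all_classical all_reals all_analysis.
Set Implicit Arguments. Unset Strict Implicit. Unset Printing Implicit Defensive.
Import Order.TTheory GRing.Theory Num.Theory.
Local Open Scope ring_scope.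

Definition AM (R : realType) (n : nat) (x : 'I_n -> R) : R :=
  (\sum_(i < n) x i) / n%:R.
Definition GM (R : realType) (n : nat) (x : 'I_n -> R) : R :=
  \prod_(i < n) (x i) `^ (n%:R^-1).
Definition AM' (R : realType) (n : nat) (x : 'I_n -> R) : R :=
  AM (fun i => 1 - x i).
Definition GM' (R : realType) (n : nat) (x : 'I_n -> R) : R :=
  GM (fun i => 1 - x i).
Definition identric (R : realType) (u v : R) : R :=
  if u == v then u
  else (expR 1)^-1 * ((u `^ u) / (v `^ v)) `^ ((u - v)^-1).

(* Main.v *)
(* The additive Ky Fan inequality A' - G' < A - G is the key fact: as A < A',
   it implies A'/G' < A/G.  Writing x_i = 1/2 - s_i, it says that
   F(1) - F(-1) > 2 F'(0) for the geometric mean F(t) of the 1/2 + t s_i, and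
   this holds because F''' > 0 on [-1, 1].  With q = u/v > 1, the expressions
   (u + v)/(u - v) ln q, the quotient of the identric by the logarithmic mean
   of u and v, and the quotient of their geometric by their logarithmic mean
   depend on q only and are monotone in q, by 2 ln q < q - 1/q and
   (q + 1) ln q > 2 (q - 1).  Each remaining inequality compares such an
   expression at A/G and at A'/G', or uses G < A < 1/2 <= G' < A'. *)
Require Import Defs.
From mathcomp Require Import all_boot all_order all_algebra.
From mathcomp Require Import all_classical all_reals all_analysis.
From mathcomp Require Import ring lra.
Import Order.TTheory GRing.Theory Num.Theory.
Import numFieldNormedType.Exports.
Local Open Scope ring_scope.

(** * Derivative rules, and strict growth from a positive derivative *)

Section Derivatives.
Context {R : realType}.
Implicit Types (f g : R -> R) (x df dg : R).

(** This rule and the next ones are phrased with explicit abstractions, the shape that [derive]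
    recognises by syntax. *)
Lemma is_derive_addfun f g x df dg : is_derive x 1 f df -> is_derive x 1 g dg ->
  is_derive x 1 (fun y => f y + g y) (df + dg).
Proof. exact: is_deriveD. Qed.

Lemma is_derive_oppfun f x df : is_derive x 1 f df ->
  is_derive x 1 (fun y => - f y) (- df).
Proof. exact: is_deriveN. Qed.

Lemma is_derive_mulfun f g x df dg : is_derive x 1 f df -> is_derive x 1 g dg ->
  is_derive x 1 (fun y => f y * g y) (f x * dg + g x * df).
Proof. exact: is_deriveM. Qed.

Lemma is_derive_invfun f x df : f x != 0 -> is_derive x 1 f df ->
  is_derive x 1 (fun y => (f y)^-1) (- (f x) ^- 2 * df).
Proof. by move=> fx0 fdf; apply: is_deriveV. Qed.

Lemma is_derive_expfun f n x df : is_derive x 1 f df ->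
  is_derive x 1 (fun y => f y ^+ n) (n%:R * f x ^+ n.-1 * df).
Proof.
move=> fdf.
have -> : (fun y => f y ^+ n) = (f ^+ n) :> (R -> R).
  by apply/funext => y; rewrite fctE.
exact: is_deriveX.
Qed.

Lemma is_derive_lnfun f x df : 0 < f x -> is_derive x 1 f df ->
  is_derive x 1 (fun y => ln (f y)) ((f x)^-1 * df).
Proof. by move=> fx0 fdf; apply: is_derive1_comp; exact: is_derive1_ln. Qed.

Lemma is_derive_expRfun f x df : is_derive x 1 f df ->
  is_derive x 1 (fun y => expR (f y)) (expR (f x) * df).
Proof. by move=> fdf; apply: is_derive1_comp; exact: is_derive_expR. Qed.

Lemma is_derive_reflect f x df : is_derive (- x) 1 f df ->
  is_derive x 1 (fun y => f (- y)) (- df).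
Proof.
by move=> fD; rewrite -mulrN1; apply: (@is_derive1_comp _ f (fun y => - y)).
Qed.

Lemma is_derive_sumfun n (h : 'I_n -> R -> R) x (dh : 'I_n -> R) :
  (forall i, is_derive x 1 (h i) (dh i)) ->
  is_derive x 1 (fun y => \sum_(i < n) h i y) (\sum_(i < n) dh i).
Proof.
move=> hdh; have -> : (fun y => \sum_(i < n) h i y) = \sum_(i < n) h i.
  by apply/funext => y; rewrite fct_sumE.
exact: is_derive_sum.
Qed.

(** Mean value theorem. Positivity is asked only inside the interval, because some of the
    derivatives below vanish at the endpoint 1. *)
Lemma is_derive_gt0_lt f (f' : R -> R) (a b : R) : a < b ->
  (forall x, a <= x <= b -> is_derive x 1 f (f' x)) ->
  (forall x, a < x < b -> 0 < f' x) -> f a < f b.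
Proof.
move=> ab fD f'0.
have fc : ({within `[a, b], continuous f})%classic.
  apply: derivable_within_continuous => x; rewrite in_itv /= => xab.
  by have [] := fD x xab.
have fD' x : x \in `]a, b[ -> is_derive x 1 f (f' x).
  by rewrite in_itv /= => /andP[ax xb]; apply: fD; rewrite !ltW.
have [c] := MVT ab fD' fc.
rewrite in_itv /= => cab e; rewrite -subr_gt0 e mulr_gt0 ?subr_gt0 //.
exact: f'0.
Qed.

End Derivatives.

(* Matching on the syntax avoids typeclass resolution, which can take minutes
   on these goals. *)
Ltac derive := repeat
  match goal with
  | H : is_derive ?x _ ?f _ |- is_derive ?x _ ?f _ => exact H
  | H : is_derive ?x _ ?f _ |- is_derive ?x _ (fun y => ?f y) _ => exact H
  | |- is_derive _ _ (fun _ => ?c) _ => exact: is_derive_cst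
  | |- is_derive _ _ (fun y => y) _ => exact: is_derive_id
  | |- is_derive _ _ (fun y => @?f y + @?g y) _ =>
      notypeclasses refine (@is_derive_addfun _ f g _ _ _ _ _)
  | |- is_derive _ _ (fun y => - @?f y) _ =>
      notypeclasses refine (@is_derive_oppfun _ f _ _ _)
  | |- is_derive _ _ (fun y => @?f y * @?g y) _ =>
      notypeclasses refine (@is_derive_mulfun _ f g _ _ _ _ _)
  | |- is_derive _ _ (fun y => (@?f y)^-1) _ =>
      notypeclasses refine (@is_derive_invfun _ f _ _ _ _)
  | |- is_derive _ _ (fun y => @?f y ^+ _) _ =>
      notypeclasses refine (@is_derive_expfun _ f _ _ _ _)
  | |- is_derive _ _ (fun y => ln (@?f y)) _ =>
      notypeclasses refine (@is_derive_lnfun _ f _ _ _ _)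
  | |- is_derive _ _ (fun y => expR (@?f y)) _ =>
      notypeclasses refine (@is_derive_expRfun _ f _ _ _)
  end.

(** * One-variable inequalities and monotonicity for the logarithm *)

Section Logarithm.
Context {R : realType}.
Implicit Types q : R.

Lemma ln_lt_subV q : 1 < q -> 2 * ln q < q - q^-1.
Proof.
move=> q1.
have := @is_derive_gt0_lt R (fun y => y - y^-1 - 2 * ln y)
  (fun y => (1 - y^-1) ^+ 2) 1 q q1.
rewrite ln1 invr1 mulr0 !subr0 subrr subr_gt0; apply.
- move=> y /andP[y1 _]; have y0 : 0 < y by lra.
  apply: is_derive_eq; first by derive; rewrite ?gt_eqF.
  by rewrite /GRing.scale /=; field; rewrite gt_eqF.
- move=> y /andP[y1 _]; rewrite exprn_gt0 // subr_gt0 invf_lt1 //; lra.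
Qed.

Lemma ln_gt_ratio q : 1 < q -> 2 * (q - 1) < (q + 1) * ln q.
Proof.
move=> q1.
have := @is_derive_gt0_lt R (fun y => ln y - 2 * (y - 1) / (y + 1))
  (fun y => (y - 1) ^+ 2 / (y * (y + 1) ^+ 2)) 1 q q1.
rewrite ln1 subrr mulr0 mul0r subr0 subr_gt0 ltr_pdivrMr 1?mulrC; last lra.
rewrite [_ * (q + 1)]mulrC; apply.
- move=> y /andP[y1 _]; have y0 : 0 < y by lra.
  have y10 : 0 < y + 1 by lra.
  apply: is_derive_eq; first by derive; rewrite ?gt_eqF.
  by rewrite /GRing.scale /=; field; rewrite !gt_eqF.
- move=> y /andP[y1 _]; rewrite divr_gt0 ?mulr_gt0 ?exprn_gt0 //; lra.
Qed.

(** Apply [ln_lt_subV] to the square root [r] of [q]: multiplied by [r] it reads r ln q < q - 1, and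
    both sides are positive. *)
Lemma ln_sqr_lt q : 1 < q -> q * ln q ^+ 2 < (q - 1) ^+ 2.
Proof.
move=> q1; pose r := Num.sqrt q.
have r1 : 1 < r by rewrite -sqrtr1 ltr_sqrt //; lra.
have r0 : 0 < r by lra.
have qE : q = r ^+ 2 by rewrite sqr_sqrtr //; lra.
have lnr := ln_gt0 r1.
have := ln_lt_subV _ r1.
rewrite qE lnXn // -mulr_natl -exprMn -(ltr_pM2l r0) => h.
rewrite (_ : r * (r - r^-1) = r ^+ 2 - 1) in h; last by field; rewrite gt_eqF.
by rewrite ltr_pXn2r // ?nnegrE; nra.
Qed.

(** The function is twice the quotient of the arithmetic by the logarithmic mean of [q] and 1; the
    sign of its derivative is [ln_lt_subV]. *)
Lemma add_sub_ln_lt q r : 1 < q -> q < r ->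
  (q + 1) / (q - 1) * ln q < (r + 1) / (r - 1) * ln r.
Proof.
move=> q1 qr.
apply: (@is_derive_gt0_lt R (fun y => (y + 1) / (y - 1) * ln y)
  (fun y => (y - y^-1 - 2 * ln y) / (y - 1) ^+ 2) q r) => //.
- move=> y /andP[qy _]; have y0 : 0 < y by lra.
  have y10 : 0 < y - 1 by lra.
  apply: is_derive_eq; first by derive; rewrite ?gt_eqF.
  by rewrite /GRing.scale /=; field; rewrite !gt_eqF.
- move=> y /andP[qy _]; have y1 : 1 < y by lra.
  by rewrite divr_gt0 ?exprn_gt0 ?subr_gt0 ?ln_lt_subV.
Qed.

(** The function is the squared quotient of the geometric by the logarithmic mean of [q] and 1. It
    decreases by [ln_gt_ratio], hence the change of sign in the proof. *)
Lemma sqr_ln_div_lt q r : 1 < q -> q < r ->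
  r * (ln r / (r - 1)) ^+ 2 < q * (ln q / (q - 1)) ^+ 2.
Proof.
move=> q1 qr; rewrite -ltrN2.
apply: (@is_derive_gt0_lt R (fun y => - (y * (ln y / (y - 1)) ^+ 2))
  (fun y => ln y * ((y + 1) * ln y - 2 * (y - 1)) / (y - 1) ^+ 3) q r) => //.
- move=> y /andP[qy _]; have y0 : 0 < y by lra.
  have y10 : 0 < y - 1 by lra.
  apply: is_derive_eq; first by derive; rewrite ?gt_eqF.
  by rewrite /GRing.scale /=; field; rewrite !gt_eqF.
- move=> y /andP[qy _]; have y1 : 1 < y by lra.
  rewrite divr_gt0 ?mulr_gt0 ?ln_gt0 ?exprn_gt0 ?subr_gt0 //.
  exact: ln_gt_ratio.
Qed.

(* Up to the constant [-1], this is the logarithm of the quotient of the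
   identric mean of [q] and [1] by their logarithmic mean. *)
Lemma identric_ratio_lt q r : 1 < q -> q < r ->
  q * ln q / (q - 1) + ln (ln q) - ln (q - 1) <
  r * ln r / (r - 1) + ln (ln r) - ln (r - 1).
Proof.
move=> q1 qr.
apply: (@is_derive_gt0_lt R
  (fun y => y * ln y / (y - 1) + ln (ln y) - ln (y - 1))
  (fun y => ((y - 1) ^+ 2 - y * ln y ^+ 2) / (y * ln y * (y - 1) ^+ 2))
  q r) => //.
- move=> y /andP[qy _]; have y0 : 0 < y by lra.
  have y10 : 0 < y - 1 by lra.
  have ly0 : 0 < ln y by apply: ln_gt0; lra.
  apply: is_derive_eq; first by derive; rewrite ?gt_eqF.
  by rewrite /GRing.scale /=; field; rewrite !gt_eqF.
- move=> y /andP[qy _]; have y1 : 1 < y by lra.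
  rewrite divr_gt0 ?mulr_gt0 ?ln_gt0 ?exprn_gt0 ?subr_gt0 ?ln_sqr_lt //; lra.
Qed.

End Logarithm.

(** * Arithmetic and geometric means of n numbers *)

Section Means.
Context {R : realType} {n : nat}.
Hypothesis n_gt0 : (0 < n)%N.
Implicit Types x z : 'I_n -> R.

Lemma AM_addfun x z : AM (fun i => x i + z i) = AM x + AM z.
Proof. by rewrite /AM big_split mulrDl. Qed.

Lemma AM_mulfun c x : AM (fun i => c * x i) = c * AM x.
Proof. by rewrite /AM -mulr_sumr mulrA. Qed.

Lemma AM_cst c : AM (fun _ : 'I_n => c) = c :> R.
Proof.
by rewrite /AM sumr_const card_ord -[c *+ n]mulr_natr mulfK // pnatr_eq0 -lt0n.
Qed.

Lemma AM_subfun c x : AM (fun i => c - x i) = c - AM x.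
Proof.
rewrite (AM_addfun (fun=> c)) AM_cst -mulN1r -AM_mulfun; congr (_ + AM _).
by apply/funext => i; rewrite mulN1r.
Qed.

Lemma AM_ge0 x : (forall i, 0 <= x i) -> 0 <= AM x.
Proof. by move=> x0; rewrite divr_ge0 // sumr_ge0. Qed.

Lemma AM_gt0 x i : (forall j, 0 <= x j) -> 0 < x i -> 0 < AM x.
Proof.
move=> x0 xi; rewrite divr_gt0 ?ltr0n // (bigD1 i) //= ltr_pwDl //.
exact: sumr_ge0.
Qed.

Lemma GM_expR x : (forall i, 0 < x i) -> GM x = expR (AM (fun i => ln (x i))).
Proof.
move=> x0; rewrite /GM /AM mulrC mulr_sumr expR_sum.
by apply: eq_bigr => i _; rewrite /powR gt_eqF.
Qed.

Lemma GM_expn x : (forall i, 0 < x i) -> GM x ^+ n = \prod_(i < n) x i.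
Proof.
move=> x0; rewrite /GM -prodrXl; apply: eq_bigr => i _.
rewrite -powR_mulrn ?powR_ge0 // -powRrM mulVf ?powRr1 ?ltW //.
by rewrite pnatr_eq0 -lt0n.
Qed.

Lemma GM_lt_AM x i j : (forall k, 0 < x k) -> x i != x j -> GM x < AM x.
Proof.
move=> x0 xij.
have G0 : 0 <= GM x by apply: prodr_ge0 => k _; exact: powR_ge0.
have A0 : 0 <= AM x by apply: AM_ge0 => k; exact: ltW.
rewrite -(@ltr_pXn2r _ n) // GM_expn //.
have [] := @leif_AGM R 'I_n predT x (fun k _ => ltW (x0 k)).
rewrite card_ord lt_neqAle => -> ->; rewrite andbT.
by apply/forall_inPn; exists i => //; apply/forall_inPn; exists j.
Qed.

(** Gives the sign of the third derivative in [GM_spread_lt], where [x k] is [s k / b t k]. *)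
Lemma mean_cubic_gt0 x i j : (forall k, 0 <= x k) -> x i != x j ->
  0 < 2 * AM (fun k => x k ^+ 3) + AM x ^+ 3
      - 3 * AM x * AM (fun k => x k ^+ 2).
Proof.
move=> x0 xij; set m := AM x.
have [k xk] : exists k, x k != m.
  by case: (eqVneq (x i) m) xij => [->|]; [rewrite eq_sym; exists j|exists i].
have m0 : 0 < m.
  have [l xl] : exists l, 0 < x l.
    case: (eqVneq (x i) 0) xij => [->|xi _]; last first.
      by exists i; rewrite lt0r xi x0.
    by rewrite eq_sym => xj; exists j; rewrite lt0r xj x0.
  exact: (AM_gt0 _ l).
(* The claim is [2 E (x (x - m) ^ 2) + m Var x > 0]. *)
have var : 0 < AM (fun l => (x l - m) ^+ 2).
  apply: (AM_gt0 _ k) => [l|]; first exact: sqr_ge0.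
  by rewrite lt0r sqrf_eq0 subr_eq0 xk sqr_ge0.
have third : 0 <= AM (fun l => x l * (x l - m) ^+ 2).
  by apply: AM_ge0 => l; rewrite mulr_ge0 ?sqr_ge0.
have varE : AM (fun l => (x l - m) ^+ 2) = AM (fun l => x l ^+ 2) - m ^+ 2.
  under [X in AM X]eq_fun => l.
    have -> : (x l - m) ^+ 2 = x l ^+ 2 + ((- 2 * m) * x l + m ^+ 2) by ring.
    over.
  by rewrite 2!AM_addfun AM_mulfun AM_cst -/m; ring.
have thirdE : AM (fun l => x l * (x l - m) ^+ 2) =
    AM (fun l => x l ^+ 3) - 2 * m * AM (fun l => x l ^+ 2) + m ^+ 3.
  under [X in AM X]eq_fun => l.
    have -> : x l * (x l - m) ^+ 2 =
      x l ^+ 3 + ((- 2 * m) * x l ^+ 2 + m ^+ 2 * x l) by ring.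
    over.
  by rewrite 2!AM_addfun 2!AM_mulfun -/m; ring.
rewrite varE in var; rewrite thirdE in third.
have := mulr_gt0 m0 var; lra.
Qed.

End Means.

(** * The additive Ky Fan inequality *)

Section AdditiveKyFan.
Context {R : realType} {n : nat}.
Hypothesis n_gt0 : (0 < n)%N.
Implicit Types x : 'I_n -> R.

Lemma is_derive_AM (h : 'I_n -> R -> R) (t : R) (dh : 'I_n -> R) :
  (forall k, is_derive t 1 (h k) (dh k)) ->
  is_derive t 1 (fun y => AM (fun k => h k y)) (AM dh).
Proof.
move=> hD; rewrite /AM; apply: is_derive_eq.
  by apply: is_derive_mulfun; apply: is_derive_sumfun.
by rewrite /= mulr0 add0r mulrC.
Qed.

(* In the notation of the proof, [F''' = (2 q3 + q1 ^ 3 - 3 q1 q2) F]. *)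
Lemma GM_spread_lt (s : 'I_n -> R) i j : (forall k, 0 <= s k < 2^-1) ->
  s i != s j ->
  2 * AM s < GM (fun k => 2^-1 + s k) - GM (fun k => 2^-1 - s k).
Proof.
move=> s_bnd sij.
pose b (t : R) k := 2^-1 + t * s k.
(* [q 1] is the logarithmic derivative of [F], and each [q m] differentiates to a multiple of
   [q m.+1]; so all derivatives of [F] are polynomials in the [q m], times [F]. *)
pose q m t := AM (fun k => (s k / b t k) ^+ m).
pose F t := expR (AM (fun k => ln (b t k))).
have b_gt0 (t : R) : -1 <= t <= 1 -> forall k, 0 < b t k.
  by move=> tb k; have := s_bnd k; rewrite /b; nra.
have qD m (t : R) : -1 <= t <= 1 -> is_derive t 1 (q m) (- (m%:R * q m.+1 t)).
  move=> tb; apply: is_derive_eq.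
    apply: is_derive_AM => k; rewrite /b; derive.
    exact: lt0r_neq0 (b_gt0 t tb k).
  rewrite -mulNr -AM_mulfun; congr AM; apply/funext => k.
  have := lt0r_neq0 (b_gt0 t tb k); rewrite -/(b t k).
  (* The power rule involves [m.-1], so [m = 0] is treated apart; both sides vanish there. *)
  move: (b t k) (s k) => d a d0; case: m => [|m].
    by rewrite !mul0r oppr0 mul0r.
  rewrite [_ ^+ m.+2]exprS [_ ^+ m.+1]exprS [_.+1.-1]/=.
  by move: (m.+1%:R) ((a / d) ^+ m) => c r; field.
have FD (t : R) : -1 <= t <= 1 -> is_derive t 1 F (q 1%N t * F t).
  move=> tb; apply: is_derive_eq.
    apply: is_derive_expRfun; apply: is_derive_AM => k; rewrite /b; derive.
    exact: b_gt0.
  rewrite mulrC; congr (_ * _).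
  by congr AM; apply/funext => k; rewrite /GRing.scale /=; ring.
pose F1 t := q 1%N t * F t.
pose F2 t := (q 1%N t ^+ 2 - q 2 t) * F t.
pose F3 t := (2 * q 3 t + q 1%N t ^+ 3 - 3 * q 1%N t * q 2 t) * F t.
have F1D (t : R) : -1 <= t <= 1 -> is_derive t 1 F1 (F2 t).
  move=> tb; have qD1 := qD 1%N t tb; have FDt := FD t tb.
  eapply is_derive_eq; first by rewrite /F1; derive.
  by rewrite /F2 /=; ring.
have F2D (t : R) : -1 <= t <= 1 -> is_derive t 1 F2 (F3 t).
  move=> tb; have qD1 := qD 1%N t tb; have qD2 := qD 2%N t tb.
  have FDt := FD t tb; eapply is_derive_eq; first by rewrite /F2; derive.
  by rewrite /F3 /=; ring.
have F3_gt0 (t : R) : -1 <= t <= 1 -> 0 < F3 t.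
  move=> tb; rewrite mulr_gt0 ?expR_gt0 //.
  have -> : q 1%N t = AM (fun k => s k / b t k) by [].
  apply: (mean_cubic_gt0 n_gt0 _ i j) => [k|].
    by rewrite divr_ge0 ?(ltW (b_gt0 t tb k)) //; case/andP: (s_bnd k).
  rewrite eqr_div ?(lt0r_neq0 (b_gt0 t tb _)) //; apply: contra sij => /eqP e.
  by apply/eqP; rewrite /b in e; lra.
(* [F1 y + F1 (- y)] has derivative [F2 y - F2 (- y)], positive for y > 0 since [F2] increases. Its
   value at 0 is [2 * AM s], because q 1 0 = 2 AM s and F 0 = 1/2. *)
have D1 (t : R) : 0 < t <= 1 -> 2 * AM s < F1 t + F1 (- t).
  move=> tb.
  have F10 : F1 0 = AM s.
    rewrite /F1 /q /F /b.
    under [X in AM X * _]eq_fun => k do rewrite mul0r addr0 invrK expr1 mulrC.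
    under [X in expR (AM X)]eq_fun => k do rewrite mul0r addr0.
    by rewrite AM_mulfun (AM_cst n_gt0) lnK ?posrE //; field.
  have <- : F1 0 + F1 (- 0) = 2 * AM s by rewrite oppr0 F10; ring.
  apply: (@is_derive_gt0_lt R (fun y => F1 y + F1 (- y))
    (fun y => F2 y - F2 (- y))); first lra.
  - move=> y yb; apply: is_derive_addfun; first by apply: F1D; lra.
    by apply: is_derive_reflect; apply: F1D; lra.
  - move=> y yb; rewrite subr_gt0.
    apply: (@is_derive_gt0_lt R F2 F3); first lra.
      by move=> z zb; apply: F2D; lra.
    by move=> z zb; apply: F3_gt0; lra.
have D0 : 0 < F 1 - F (- 1) - 2 * AM s.
  (* Both sides become values, at 0 and at 1, of one function whose derivative is positive by
     [D1]. *)
  have -> : 0 = F 0 - F (- 0) - 0 * (2 * AM s) by rewrite oppr0; ring.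
  rewrite -[X in _ < _ - X]mul1r.
  apply: (@is_derive_gt0_lt R (fun y => F y - F (- y) - y * (2 * AM s))
    (fun y => F1 y + F1 (- y) - 2 * AM s)) => //.
  - move=> y yb; have FDy : is_derive y 1 F (F1 y) by apply: FD; lra.
    have FDNy : is_derive y 1 (fun z => F (- z)) (- F1 (- y)).
      by apply: is_derive_reflect; apply: FD; lra.
    eapply is_derive_eq; first by derive.
    by rewrite /=; ring.
  - by move=> y yb; rewrite subr_gt0 D1 //; lra.
have GF1 : GM (fun k => 2^-1 + s k) = F 1.
  rewrite GM_expR => [|k]; last by have := s_bnd k; lra.
  by rewrite /F /b; under [X in _ = expR (AM X)]eq_fun => k do rewrite mul1r.
have GF1N : GM (fun k => 2^-1 - s k) = F (- 1).
  rewrite GM_expR => [|k]; last by have := s_bnd k; lra.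
  by rewrite /F /b; under [X in _ = expR (AM X)]eq_fun => k do rewrite mulN1r.
by rewrite GF1 GF1N; lra.
Qed.

(** For s = 1/2 - x, 2 AM s = 1 - 2A = A' - A, so [GM_spread_lt] reads A' - A < G' - G. *)
Lemma additive_Ky_Fan x i j : (forall k, 0 < x k <= 2^-1) -> x i != x j ->
  AM' x - GM' x < AM x - GM x.
Proof.
move=> xb xij.
have := @GM_spread_lt (fun k => 2^-1 - x k) i j _ _.
have AE := AM_subfun n_gt0; rewrite /AM' !AE.
have -> : (fun k => 2^-1 + (2^-1 - x k)) = (fun k => 1 - x k).
  by apply/funext => k; field.
have -> : (fun k => 2^-1 - (2^-1 - x k)) = x.
  by apply/funext => k; field.
rewrite -/(GM' x) => h.
have {h} : 2 * (2^-1 - AM x) < GM' x - GM x.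
  apply: h => [k|]; first by have := xb k; lra.
  by apply: contra xij => /eqP e; apply/eqP; lra.
lra.
Qed.

End AdditiveKyFan.

(** * Identric and logarithmic means of two numbers *)

Section TwoVariableMeans.
Context {R : realType}.
Implicit Types u v q r : R.

Lemma gt1_ltr_powR q : 1 < q -> {mono powR q : a b / a < b}.
Proof.
move=> q1 a b; rewrite /powR gt_eqF ?ltr_expR ?ltr_pM2r ?ln_gt0 //.
exact: lt_trans q1.
Qed.

Lemma ratio_gt1 u v : 0 < v < u -> 1 < u / v.
Proof. by case/andP=> v0 vu; rewrite ltr_pdivlMr ?mul1r. Qed.

(** Both bounds are ln y <= y - 1, taken at [u / v] and at [v / u]. The middle term is the inverse
    of the logarithmic mean. *)
Lemma ln_ratio_bounds u v : 0 < v < u ->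
  u^-1 <= (u - v)^-1 * ln (u / v) <= v^-1.
Proof.
move=> /andP[v0 vu]; have u0 := lt_trans v0 vu.
have uv0 : 0 < u - v by rewrite subr_gt0.
have ln_le (a b : R) : 0 < a -> 0 < b -> ln (a / b) <= (a - b) / b.
  move=> a0 b0; have -> : a / b = 1 + (a - b) / b.
    by field; exact: lt0r_neq0.
  by apply: le_ln1Dx; rewrite ltr_pdivlMr // mulN1r; lra.
rewrite mulrC ler_pdivlMr // ler_pdivrMr // [v^-1 * _]mulrC ln_le // andbT.
have := ln_le v u v0 u0; rewrite -[v / u]invf_div lnV ?posrE ?divr_gt0 //.
have -> : (v - u) / u = - (u^-1 * (u - v)) by field; exact: lt0r_neq0.
by rewrite lerN2.
Qed.

Lemma identricE u v : 0 < v < u ->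
  identric u v = expR ((u * ln u - v * ln v) / (u - v) - 1).
Proof.
move=> /andP[v0 vu]; have u0 := lt_trans v0 vu.
rewrite /identric gt_eqF // /powR !gt_eqF ?divr_gt0 ?expR_gt0 //.
rewrite ln_div ?posrE ?expR_gt0 // !expRK -expRN -expRD; congr expR.
by rewrite addrC mulrC.
Qed.

(** After taking logarithms, the two bounds are those of [ln_ratio_bounds] multiplied by [u] and by
    [v]. *)
Lemma identric_bounds u v : 0 < v < u -> v <= identric u v <= u.
Proof.
move=> uv; have /andP[v0 vu] := uv; have u0 := lt_trans v0 vu.
have uv0 : 0 < u - v by rewrite subr_gt0.
have := ln_ratio_bounds _ _ uv; rewrite ln_div ?posrE // mulrC.
rewrite ler_pdivlMr // ler_pdivrMr // => /andP[lo hi].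
have {}lo : u - v <= u * (ln u - ln v).
  by rewrite -(ler_pM2l u0) mulrA mulfV ?gt_eqF // mul1r in lo.
have {}hi : v * (ln u - ln v) <= u - v.
  by rewrite -(ler_pM2l v0) mulrA mulfV ?gt_eqF // mul1r in hi.
rewrite identricE //; apply/andP; split.
- rewrite -[leLHS]lnK ?posrE // ler_expR lerBrDr ler_pdivlMr //; lra.
- rewrite -[leRHS]lnK ?posrE // ler_expR lerBlDr ler_pdivrMr //; lra.
Qed.

Section CompareRatios.
Variables u v u' v' : R.
Hypotheses (uv : 0 < v < u) (uv' : 0 < v' < u') (ratio_lt : u' / v' < u / v).

(** By homogeneity, [E] replaces the pair (a, b) by (a / b, 1), here and in the next two lemmas. *)
Lemma sum_div_logmean_lt :
  (u' + v') / (u' - v') * ln (u' / v') < (u + v) / (u - v) * ln (u / v).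
Proof.
have E (a b : R) : 0 < b < a -> (a + b) / (a - b) = (a / b + 1) / (a / b - 1).
  move=> /andP[b0 ba]; field.
  by rewrite !lt0r_neq0 //; lra.
by rewrite (E _ _ uv) (E _ _ uv'); apply: add_sub_ln_lt => //; apply: ratio_gt1.
Qed.

Lemma geomean_div_logmean_lt :
  u * v * ((u - v)^-1 * ln (u / v)) ^+ 2 <
  u' * v' * ((u' - v')^-1 * ln (u' / v')) ^+ 2.
Proof.
have E (a b : R) : 0 < b < a -> a * b * ((a - b)^-1 * ln (a / b)) ^+ 2 =
    a / b * (ln (a / b) / (a / b - 1)) ^+ 2.
  move=> /andP[b0 ba]; move: (ln _) => l; field.
  by rewrite !lt0r_neq0 //; lra.
by rewrite (E _ _ uv) (E _ _ uv'); apply: sqr_ln_div_lt => //; apply: ratio_gt1.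
Qed.

Lemma identric_div_logmean_lt :
  identric u' v' * ((u' - v')^-1 * ln (u' / v')) <
  identric u v * ((u - v)^-1 * ln (u / v)).
Proof.
have E (a b : R) : 0 < b < a -> identric a b * ((a - b)^-1 * ln (a / b)) =
    expR (a / b * ln (a / b) / (a / b - 1) + ln (ln (a / b))
          - ln (a / b - 1) - 1).
  move=> ab; have q1 := ratio_gt1 _ _ ab; have /andP[b0 ba] := ab.
  have a0 := lt_trans b0 ba; have ab0 : 0 < a - b by rewrite subr_gt0.
  (* The [ln b] that this leaves in the identric mean matches the one in ln (a / b - 1) = ln (a - b)
     - ln b. *)
  have lnaE : ln a = ln b + ln (a / b) by rewrite ln_div ?posrE //; ring.
  have := ln_gt0 q1; have -> : a / b - 1 = (a - b) / b.
    by field; exact: lt0r_neq0.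
  rewrite [ln ((a - b) / b)]ln_div ?posrE // identricE // lnaE.
  move: (ln (a / b)) => l l0; rewrite -[(a - b)^-1 * _]lnK; last first.
    by rewrite posrE mulr_gt0 ?invr_gt0.
  rewrite -expRD lnM ?posrE ?invr_gt0 // lnV ?posrE //; congr expR.
  by field; rewrite !lt0r_neq0 //; lra.
rewrite [X in X < _](E _ _ uv') [X in _ < X](E _ _ uv) ltr_expR ltrD2r.
exact: identric_ratio_lt (ratio_gt1 _ _ uv') ratio_lt.
Qed.

End CompareRatios.

End TwoVariableMeans.

(** * The three chains of inequalities *)

Theorem theorem4p3 (R : realType) (n : nat) (x : 'I_n -> R) :
  (1 <= n)%N ->
  (forall i, 0 < x i <= 2^-1) ->
  (exists i j, x i != x j) ->
  let A := AM x in let G := GM x in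
  let A' := AM' x in let G' := GM' x in
  let Q := A / G in let Q' := A' / G' in
  let e1 := (A + G) / (A' + G') in
  let e2 := (A' - G') / (A - G) in
  let eI := identric A' G' / identric A G * ((A - G) / (A' - G')) in
  let L1 := (((A' - G')^-1 * ln (A' / G')) / ((A - G)^-1 * ln (A / G))) ^+ 2 in
  let L2 := (((A' ^+ n - G' ^+ n)^-1 * ln (A' ^+ n / G' ^+ n))
              / ((A ^+ n - G ^+ n)^-1 * ln (A ^+ n / G ^+ n))) `^ (2 / n%:R) in
  [/\ Q' < Q `^ (e1 * e2) < Num.min (Q `^ e1) (Q `^ e2),
      Num.min (Q `^ e1) (Q `^ e2) < Q,
      Q' < Q' `^ eI < Q
    & (A * G) / (A' * G') < Num.min L1 L2 < 1].
Proof.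
move=> n_gt0 x_bnd [i [j xij]] A G A' G'.
have x_gt0 k : 0 < x k by case/andP: (x_bnd k).
have x'_ge k : 2^-1 <= 1 - x k by have := x_bnd k; lra.
have x'_gt0 k : 0 < 1 - x k by have := x_bnd k; lra.
have G_gt0 : 0 < G by apply: prodr_gt0 => k _; exact: powR_gt0.
have GA : G < A by exact: (GM_lt_AM n_gt0 _ i j).
have GA' : G' < A'.
  apply: (GM_lt_AM n_gt0 _ i j) => //.
  by apply: contra xij => /eqP e; apply/eqP; lra.
have AA' : A' = 1 - A by exact: (AM_subfun n_gt0).
have G'_ge : 2^-1 <= G'.
  have G'0 : 0 <= G' by apply: prodr_ge0 => k _; exact: powR_ge0.
  rewrite -(@ler_pXn2r _ n) ?nnegrE ?invr_ge0 // /G' /GM' GM_expn //.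
  rewrite -[n in X in X <= _]card_ord -prodr_const ler_prod // => k _.
  by rewrite x'_ge invr_ge0 ler0n.
have KF : A' - G' < A - G by exact: (additive_Ky_Fan n_gt0 _ i j).
(* The numbers [x k] are no longer needed: only [n] and relations among the four means remain. *)
clearbody A G A' G'; clear x i j x_bnd xij x_gt0 x'_ge x'_gt0.
have G'_gt0 : 0 < G' by lra.
have uv : 0 < G < A by rewrite G_gt0.
have uv' : 0 < G' < A' by rewrite G'_gt0.
have A_gt0 : 0 < A by lra.
have A'_gt0 : 0 < A' by lra.
have dA : 0 < A - G by lra.
have dA' : 0 < A' - G' by lra.
(* 1 - A = A' > G' >= 1/2. *)
have A_lt : A < 2^-1 by lra.
have sum_lt : A + G < A' + G' by lra.
(* Equivalent to (A' - G') G < (A - G) G', which follows from [KF] and G < G'. *)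
have ratio_lt : A' / G' < A / G.
  rewrite ltr_pdivrMr // mulrAC ltr_pdivlMr //; nra.
have /andP[G_le_I I_le_A] := identric_bounds _ _ uv.
have /andP[G'_le_I' _] := identric_bounds _ _ uv'.
have I_gt0 := lt_le_trans G_gt0 G_le_I.
have I_lt_I' : identric A G < identric A' G'.
  apply: le_lt_trans I_le_A _; apply: lt_le_trans A_lt _.
  exact: le_trans G'_ge G'_le_I'.
have I_logmean_lt := identric_div_logmean_lt _ _ _ _ uv uv' ratio_lt.
move: I_gt0 I_lt_I' I_logmean_lt; clear G_le_I I_le_A G'_le_I' GA GA' AA'.
move: (identric A G) (identric A' G') => I I' I_gt0 I_lt_I' I_logmean_lt
  Q Q' e1 e2 eI L1 L2.
have Q1 : 1 < Q by exact: ratio_gt1.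
have Q'1 : 1 < Q' by exact: ratio_gt1.
have lnQ := ln_gt0 Q1.
have e1_gt0 : 0 < e1 by rewrite divr_gt0 // addr_gt0.
have e1_lt1 : e1 < 1 by rewrite ltr_pdivrMr ?mul1r // addr_gt0.
have e2_gt0 : 0 < e2 by rewrite divr_gt0.
have e2_lt1 : e2 < 1 by rewrite ltr_pdivrMr ?mul1r.
have Q_gt0 := lt_trans ltr01 Q1.
have Q'_gt0 := lt_trans ltr01 Q'1.
split.
- rewrite lt_min !gt1_ltr_powR // gtr_pMr // gtr_pMl // e1_lt1 e2_lt1 !andbT.
  rewrite -ltr_ln ?posrE ?powR_gt0 // ln_powR.
  have := sum_div_logmean_lt _ _ _ _ uv uv' ratio_lt.
  rewrite -/Q -/Q' /e1 /e2 => h.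
  (* This factor cancels the primed part of [e1 * e2] and turns the goal into [h]. *)
  rewrite -(ltr_pM2l (_ : 0 < (A' + G') / (A' - G'))); last first.
    by rewrite divr_gt0 // addr_gt0.
  apply: lt_le_trans h _; rewrite le_eqVlt; apply/orP; left; apply/eqP.
  by field; rewrite !lt0r_neq0 // addr_gt0.
- by rewrite gt_min -{2}[Q]powRr1 ?ltW // gt1_ltr_powR // e1_lt1.
- apply/andP; split.
    (* Both factors of [eI] exceed 1: the first by [I_lt_I'], the second by [KF]. *)
    rewrite -{1}[Q']powRr1 ?ltW // gt1_ltr_powR // mulr_egt1 //.
      by rewrite ltr_pdivlMr ?mul1r.
    by rewrite ltr_pdivlMr ?mul1r.
  rewrite -ltr_ln ?posrE ?powR_gt0 // ln_powR.
  rewrite -(ltr_pM2l (_ : 0 < I / (A - G))) ?divr_gt0 //.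
  rewrite -[X in _ < X]mulrA; apply: le_lt_trans I_logmean_lt.
  rewrite le_eqVlt; apply/orP; left; apply/eqP; rewrite /eI.
  by field; rewrite !lt0r_neq0.
- have rho_gt0 (a b : R) : 0 < b < a -> 0 < (a - b)^-1 * ln (a / b).
    by move=> ab; rewrite mulr_gt0 ?invr_gt0 ?subr_gt0 ?ln_gt0 ?ratio_gt1 //;
      case/andP: ab.
  (* Stated for arbitrary pairs: it serves the means themselves for [L1] and their n-th powers for
     [L2]. *)
  have sep (a b a' b' : R) : 0 < b < a -> 0 < b' < a' -> a' / b' < a / b ->
      a * b / (a' * b') < (((a' - b')^-1 * ln (a' / b')) /
                          ((a - b)^-1 * ln (a / b))) ^+ 2.
    move=> ab ab' lt_r; have h := geomean_div_logmean_lt _ _ _ _ ab ab' lt_r.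
    have r0 := rho_gt0 _ _ ab; have /andP[b'0 b'a'] := ab'.
    have a'0 := lt_trans b'0 b'a'.
    rewrite expr_div_n ltr_pdivrMr ?mulr_gt0 //.
    by rewrite mulrAC ltr_pdivlMr ?exprn_gt0 // [X in _ < X]mulrC.
  apply/andP; split; last first.
    (* [L1] suffices: with L the logarithmic mean, its base is L(A, G) / L(A', G'), and L(A, G) <= A
       < 1/2 <= G' <= L(A', G'). *)
    rewrite gt_min; apply/orP; left; rewrite /L1 expr_lt1 //; last first.
      by rewrite divr_ge0 ?ltW ?rho_gt0.
    rewrite ltr_pdivrMr ?rho_gt0 // mul1r.
    have /andP[_ L'_le] := ln_ratio_bounds _ _ uv'.
    have /andP[L_ge _] := ln_ratio_bounds _ _ uv.
    apply: le_lt_trans L'_le _; apply: lt_le_trans L_ge.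
    by rewrite ltf_pV2 ?posrE //; apply: lt_le_trans A_lt _.
  rewrite lt_min sep //=.
  have n_neq0 : n != 0%N by rewrite -lt0n.
  have powAG (a b : R) : 0 < b < a -> 0 < b ^+ n < a ^+ n.
    move=> /andP[b0 ba]; have a0 := lt_trans b0 ba.
    by rewrite exprn_gt0 //= ltr_pXn2r ?nnegrE ?ltW.
  have powQ : A' ^+ n / G' ^+ n < A ^+ n / G ^+ n.
    by rewrite -!expr_div_n ltr_pXn2r // nnegrE ltW.
  have := sep _ _ _ _ (powAG _ _ uv) (powAG _ _ uv') powQ.
  set X := _ / _ => h.
  have X_gt0 : 0 < X by rewrite divr_gt0 ?rho_gt0 ?powAG.
  rewrite /L2 powRrM powR_mulrn ?ltW //.
  have AG_gt0 : 0 < A * G / (A' * G') by rewrite divr_gt0 ?mulr_gt0.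
  have powK (a : R) : 0 < a -> a = (a ^+ n) `^ n%:R^-1.
    move=> a0; rewrite -powR_mulrn ?ltW // -powRrM mulfV ?pnatr_eq0 //.
    by rewrite powRr1 ?ltW.
  (* Both sides are now n-th roots, on the right of the squared base of [L2]; the inequality between
     the radicands is [h]. *)
  rewrite [X in X < _](powK _ AG_gt0).
  apply: gt0_ltr_powR; first by rewrite invr_gt0 ltr0n.
  + by rewrite nnegrE exprn_ge0 // ltW.
  + by rewrite nnegrE exprn_ge0 // ltW.
  + by move: h; rewrite -!exprMn -expr_div_n; apply.
Qed.
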